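(* Let $X$ be a separable Banach space over $\mathbb{K}$. Suppose there is $\varepsilon>0$ such that each nonempty relatively weak* open subset of $D_{X^*}$ has norm-diameter at least $\varepsilon$. Then there is a balanced norm-open set $U\subsetneqq B_{X^*}$ such that $\tilde U=U$ and $U$ is weak* dense in $B_{X^*}$.
   Context: $\mathbb{K}$ denotes either $\mathbb{R}$ or $\mathbb{C}$. $B_{X^*}$ and $D_{X^*}$ are the open and closed unit balls of the dual $X^*$. $U$ is balanced if $tU\subset U$ for all $t\in\mathbb{K}$ with $|t|\le 1$. For a norm-open set $U\subset X^*$, a subset $B\subset U$ is called $U$-bounded if it is bounded and has positive distance to $X^*\setminus U$ (the distance condition being void if $U=X^*$). The envelope of $U$ is $\tilde U:=\bigcup\{\overline{B}^{w^*}: B\subset U \text{ is } U\text{-bounded}\}$, where $\overline{B}^{w^*}$ is the weak* closure in $X^*$ (with respect to $w(X^*,X)$). *)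

(* Defs.v *)
From HB Require Import structures.
From mathcomp Require Import all_boot all_order all_algebra.
From mathcomp Require Import complex.
From mathcomp Require Import all_classical all_reals all_analysis.

Set Implicit Arguments.
Unset Strict Implicit.
Unset Printing Implicit Defensive.

Import Order.TTheory GRing.Theory Num.Theory.
Import numFieldNormedType.Exports.

Local Open Scope classical_set_scope.
Local Open Scope ring_scope.

Inductive scalar_kind := RealScalars | ComplexScalars.

Definition scalars (R : realType) (k : scalar_kind) : numFieldType :=
  match k with
  | RealScalars => R
  | ComplexScalars => R[i]
  end.

(* Norms on a module over K take their values in K. Over R[i] the order is
   partial (z <= w iff Im z = Im w and Re z <= Re w), so that a set of norms
   has a least upper bound as soon as it is nonempty and bounded above. *)
Lemma scalars_supremums (R : realType) (k : scalar_kind)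
    (A : set (scalars R k)) : A `<=` [set x | 0 <= x] -> has_ubound A ->
  A !=set0 -> supremums A !=set0.
Proof.
case: k A => A A0 [M AM] [a Aa].
  have hA : has_sup (A : set R) by split; [exists a|exists M].
  exists (sup (A : set R)); split; first exact: (sup_upper_bound hA).
  by move=> x Ax; apply: ge_sup => //; exists a.
have real x : A x -> x = (complex.Re x)%:C%C.
  by move=> /A0 /=; case: x => x y; rewrite lecE /= => /andP[/eqP -> _].
pose B := @complex.Re R @` A.
have BRe x y : A x -> x <= y -> complex.Re x <= complex.Re y.
  by move=> _; rewrite lecE => /andP[].
have hB : has_sup B.
  split; first by exists (complex.Re a), a.
  by exists (complex.Re M) => _ [x Ax <-]; exact: BRe (AM _ Ax).
exists ((sup B)%:C%C); split => [x Ax|y Ay].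
  rewrite (real _ Ax) lecR; apply: (sup_upper_bound hB); by exists x.
have y0 : complex.Im y = 0.
  have := Ay _ Aa; rewrite (real _ Aa) lecE => /andP[/eqP + _].
  by [].
rewrite lecE /= y0 eqxx /=; apply: ge_sup; first by case: hB.
by move=> _ [x Ax <-]; exact: BRe (Ay _ Ax).
Qed.

Lemma scalars_supremumP (R : realType) (k : scalar_kind)
    (A : set (scalars R k)) : A `<=` [set x | 0 <= x] -> has_ubound A ->
  A !=set0 -> supremums A (supremum 0 A).
Proof.
move=> A0 Aub An0; rewrite /supremum ifF; last first.
  by apply/negbTE/set0P.
by case: xgetP => [y _ //|]; have [x Ax] := scalars_supremums A0 Aub An0 => /(_ x).
Qed.

Section dual.
Variables (R : realType) (k : scalar_kind).
Notation K := (scalars R k).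
Variable X : normedModType K.

Definition dual_pred : {pred X -> K^o} :=
  mem [set f : X -> K^o | linear f /\ continuous f].

Lemma dual_submod_closed : submod_closed dual_pred.
Proof.
split=> [|a f g]; rewrite !inE.
  split; last by move=> x; exact: cst_continuous.
  by move=> a x y; rewrite -[RHS]/(a *: 0 + 0 : K^o) scaler0 addr0.
move=> [lf cf] [lg cg]; split.
  move=> b x y; rewrite -[LHS]/(a *: f (b *: x + y) + g (b *: x + y)).
  rewrite -[RHS]/(b *: (a *: f x + g x) + (a *: f y + g y)).
  by rewrite lf lg !scalerDr !scalerA (mulrC a b) addrACA.
move=> x; apply: (@continuousD K K^o X (a \*: f) g x); last exact: cg.
by apply: continuousZr; exact: cf.
Qed.

HB.instance Definition _ :=
  GRing.isSubmodClosed.Build _ _ dual_pred dual_submod_closed.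

Record dual := Dual { dual_val :> X -> K^o; dualP : dual_val \in dual_pred }.

HB.instance Definition _ := [isSub for dual_val].
HB.instance Definition _ := [Choice of dual by <:].
HB.instance Definition _ := [SubChoice_isSubLmodule of dual by <:].

Definition dual_norm (f : dual) : K :=
  supremum 0 [set `|f x| | x in [set x | `|x| <= 1]].

Lemma dual_linear (f : dual) : linear f.
Proof. by have := dualP f; rewrite inE => -[]. Qed.

Lemma dual_continuous (f : dual) : continuous f.
Proof. by have := dualP f; rewrite inE => -[]. Qed.

HB.instance Definition _ (f : dual) :=
  GRing.isLinear.Build K X K^o *:%R (dual_val f) (dual_linear f).

Lemma dual_norm_supremums (f : dual) :
  supremums [set `|f x| | x in [set x | `|x| <= 1]] (dual_norm f).
Proof.
apply: scalars_supremumP.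
- by move=> _ [x _ <-] /=.
- have /linear_boundedP/pinfty_ex_gt0[M M0 fM] : bounded_near f (nbhs (0 : X)).
    by apply: continuous_linear_bounded; exact: dual_continuous.
  exists M => _ [x /= x1 <-]; apply: le_trans (fM x) _.
  by rewrite ger_pMr.
- by exists `|f 0|, 0 => //=; rewrite normr0.
Qed.

Lemma dual_norm_ub (f : dual) x : `|f x| <= dual_norm f * `|x|.
Proof.
have [->|x0] := eqVneq x 0; first by rewrite linear0 !normr0 mulr0.
rewrite -ler_pdivrMr ?normr_gt0//.
have [+ _] := dual_norm_supremums f; apply.
exists (`|x|^-1 *: x) => /=; first by rewrite normrZ normfV normr_id mulVf ?normr_eq0.
by rewrite linearZ /= normrZ normfV normr_id mulrC.
Qed.

Lemma dual_norm_le (f : dual) (M : K) :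
  (forall x, `|x| <= 1 -> `|f x| <= M) -> dual_norm f <= M.
Proof.
by move=> fM; have [_] := dual_norm_supremums f; apply => _ [x x1 <-]; exact: fM.
Qed.

Lemma dual_norm_ge0 (f : dual) : 0 <= dual_norm f.
Proof.
have [+ _] := dual_norm_supremums f; apply.
by exists 0; rewrite /= ?linear0 ?normr0.
Qed.

Lemma dual_normD (f g : dual) :
  dual_norm (f + g) <= dual_norm f + dual_norm g.
Proof.
apply: dual_norm_le => x x1; apply: le_trans (ler_normD _ _) _.
apply: lerD; apply: le_trans (dual_norm_ub _ _) _.
  by rewrite ler_piMr// dual_norm_ge0.
by rewrite ler_piMr// dual_norm_ge0.
Qed.

Lemma dual_normZ_le (a : K) (f : dual) :
  dual_norm (a *: f) <= `|a| * dual_norm f.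
Proof.
apply: dual_norm_le => x x1; rewrite normrZ ler_wpM2l//.
by apply: le_trans (dual_norm_ub _ _) _; rewrite ler_piMr// dual_norm_ge0.
Qed.

Lemma dual_norm_eq0 (f : dual) : dual_norm f = 0 -> f = 0.
Proof.
move=> f0; apply: val_inj; apply/funext => x; apply/eqP.
by rewrite -normr_le0; have := dual_norm_ub f x; rewrite f0 mul0r.
Qed.

Lemma dual_normZ (a : K) (f : dual) : dual_norm (a *: f) = `|a| * dual_norm f.
Proof.
have [->|a0] := eqVneq a 0.
  rewrite normr0 mul0r scale0r; apply/eqP; rewrite eq_le dual_norm_ge0 andbT.
  by apply: dual_norm_le => x _; rewrite normr0.
apply/eqP; rewrite eq_le dual_normZ_le /= mulrC -ler_pdivlMr ?normr_gt0//.
rewrite mulrC -normfV; apply: le_trans (dual_normZ_le _ _).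
by rewrite scalerA mulVf// scale1r.
Qed.

HB.instance Definition _ :=
  Lmodule_isNormed.Build K dual dual_normD dual_normZ dual_norm_eq0.

(* The functionals again, with the topology w(X^*, X) of pointwise convergence
   on X instead of the norm topology. *)
Definition weak_star : Type :=
  initial_topology (fun f : dual => dual_val f : {ptws X -> K^o}).

HB.instance Definition _ := Topological.copy weak_star
  (initial_topology (fun f : dual => dual_val f : {ptws X -> K^o})).

End dual.

Definition separable (T : topologicalType) :=
  exists2 S : set T, countable S & dense S.

Section normed.
Variables (K : numFieldType) (V : normedModType K).

Definition open_unit_ball : set V := [set x | `|x| < 1].

Definition closed_unit_ball : set V := [set x | `|x| <= 1].

(* The supremum takes the default value 0 when A is empty or unbounded. *)
Definition diameter (A : set V) : K :=
  supremum 0 [set `|x - y| | x in A & y in A].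

Definition balanced (U : set V) :=
  forall t : K, `|t| <= 1 -> [set t *: x | x in U] `<=` U.

(* Positive distance is spelled out as a uniform lower bound, so that the
   condition is void when U is the whole space. *)
Definition U_bounded (U B : set V) :=
  [/\ B `<=` U, bounded_set B &
      exists2 d : K, 0 < d & forall x y, B x -> ~ U y -> d <= `|x - y|].

End normed.

Arguments open_unit_ball {K} V.
Arguments closed_unit_ball {K} V.

Section envelope.
Variables (R : realType) (k : scalar_kind) (X : normedModType (scalars R k)).

Definition weak_star_closure (A : set (dual X)) : set (dual X) :=
  closure (A : set (weak_star X)).

Definition envelope (U : set (dual X)) : set (dual X) :=
  \bigcup_(B in U_bounded U) weak_star_closure B.

End envelope.

(* Main.v *)
Require Import Defs.
From mathcomp Require Import all_boot all_order all_algebra.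
From mathcomp Require Import complex ring lra.
From mathcomp Require Import all_classical all_reals all_analysis.

(* Weak*-closed balls of radius < eps / 2 have too small a diameter to contain a
   nonempty relatively weak*-open subset of the dual ball, so finitely many of
   them never cover one. Hence, running through a countable family of weak*-open
   sets, one can choose points x_n of the dual ball, weak*-dense in it, with x_n
   at distance at least delta from all the lines K x_m, m < n. Let U be the union
   of a small ball r B and of the tubes of radius q / (n + 1) around the lines
   K x_n, intersected with the open unit ball. Away from r B a point is close to
   at most one line; hence a ball of radius d contained in U that is not near r B
   has a sub-ball inside a single tube, and moving in the direction x_(n+1) shows
   that the radius of that tube is at least of order d. So a U-bounded set lies in r B
   and finitely many tubes, and, by dilating it a little, in shrunken copies of
   these. A shrunken tube is covered by finitely many balls contained in the tube,
   and these are weak*-closed. *)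

Import Order.TTheory GRing.Theory Num.Theory.
Import numFieldNormedType.Exports.

Local Open Scope classical_set_scope.
Local Open Scope ring_scope.

(** * Real-valued norms over either scalar field *)

Section scalars.
Context {R : realType} {k : scalar_kind}.
Notation K := (scalars R k).

Definition of_real : R -> K :=
  match k return R -> scalars R k with
  | RealScalars => fun x => x
  | ComplexScalars => fun x => x%:C%C
  end.

Definition real_part : K -> R :=
  match k return scalars R k -> R with
  | RealScalars => fun x => x
  | ComplexScalars => @complex.Re R
  end.

Lemma of_realK : cancel of_real real_part.
Proof. by rewrite /of_real /real_part; case: k. Qed.

Lemma real_partK (z : K) : 0 <= z -> of_real (real_part z) = z.
Proof.
rewrite /of_real /real_part; case: k z => //= -[x y].
by rewrite lecE /= => /andP[/eqP ->].
Qed.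

Lemma le_of_real (x y : R) : (of_real x <= of_real y) = (x <= y).
Proof. by rewrite /of_real; case: k => //=; rewrite lecR. Qed.

Lemma lt_of_real (x y : R) : (of_real x < of_real y) = (x < y).
Proof. by rewrite /of_real; case: k => //=; rewrite ltcR. Qed.

Lemma of_realD (x y : R) : of_real (x + y) = of_real x + of_real y.
Proof. by rewrite /of_real; case: k => //=; rewrite rmorphD. Qed.

Lemma of_realM (x y : R) : of_real (x * y) = of_real x * of_real y.
Proof. by rewrite /of_real; case: k => //=; rewrite rmorphM. Qed.

Lemma of_real0 : of_real 0 = 0.
Proof. by rewrite /of_real; case: k. Qed.

Lemma of_real1 : of_real 1 = 1.
Proof. by rewrite /of_real; case: k. Qed.

Lemma gt0_of_real (z : K) : 0 < z -> exists2 x : R, 0 < x & z = of_real x.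
Proof.
move=> z0; have zE := real_partK z (ltW z0).
by exists (real_part z); rewrite // -lt_of_real of_real0 zE.
Qed.

Lemma norm_of_real (x : R) : `|of_real x| = of_real `|x|.
Proof. by rewrite /of_real; case: k => //=; rewrite normc_def /= expr0n addr0 sqrtr_sqr. Qed.

(** Norms take values in [K], whose order is only partial in the complex case; real values allow
    total comparison and linear arithmetic. *)
Definition rnorm {V : normedModType K} (v : V) : R := real_part `|v|.

Section rnorm.
Context {V : normedModType K}.
Implicit Types v w : V.

Lemma normE v : `|v| = of_real (rnorm v).
Proof. by rewrite real_partK. Qed.

Lemma rnorm_ge0 v : 0 <= rnorm v.
Proof. by rewrite -le_of_real of_real0 -normE. Qed.

Lemma rnormD v w : rnorm (v + w) <= rnorm v + rnorm w.
Proof. by rewrite -le_of_real of_realD -!normE ler_normD. Qed.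

Lemma rnormN v : rnorm (- v) = rnorm v.
Proof. by rewrite /rnorm normrN. Qed.

Lemma rnormB v w : rnorm (v - w) <= rnorm v + rnorm w.
Proof. by rewrite -(rnormN w) rnormD. Qed.

Lemma rnorm_distrC v w : rnorm (v - w) = rnorm (w - v).
Proof. by rewrite /rnorm distrC. Qed.

Lemma rnorm0 : rnorm (0 : V) = 0.
Proof. by rewrite /rnorm normr0 -of_real0 of_realK. Qed.

Lemma rnorm_split w v : rnorm v <= rnorm w + rnorm (v - w).
Proof. by have := rnormD w (v - w); rewrite addrC subrK. Qed.

Lemma rnorm_dist_le v u w : rnorm (u - w) <= rnorm (v - w) + rnorm (v - u).
Proof.
have -> : u - w = v - w - (v - u) by rewrite opprB [RHS]addrC addrA subrK.
exact: rnormB.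
Qed.

Lemma rnorm_dist_lt4 (h : R) (c p p' q q' : V) :
  rnorm (p - p') < h / 4 -> rnorm (q - q') < h / 4 ->
  rnorm (p' - c) < h / 4 -> rnorm (q' - c) < h / 4 -> rnorm (p - q) < h.
Proof.
have := rnorm_dist_le p' p q; have := rnorm_dist_le q' p' q.
have := rnorm_dist_le c p' q'.
rewrite (rnorm_distrC c p') (rnorm_distrC c q') (rnorm_distrC p' p) (rnorm_distrC q' q).
by rewrite (rnorm_distrC q' p'); lra.
Qed.

Lemma rnorm_eq0 v : (rnorm v == 0) = (v == 0).
Proof.
rewrite -(normr_eq0 v) normE -of_real0.
by apply/eqP/eqP => [->//|/(congr1 real_part)]; rewrite !of_realK.
Qed.

Lemma rnormZ (t : K) v : rnorm (t *: v) = rnorm (t : K^o) * rnorm v.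
Proof.
by rewrite -[RHS]of_realK of_realM /rnorm !real_partK ?normr_ge0// normrZ.
Qed.

Lemma rnorm_real (x : R) : 0 <= x -> rnorm (of_real x : K^o) = x.
Proof. by move=> x0; rewrite /rnorm norm_of_real of_realK ger0_norm. Qed.

Lemma rnorm_of_real (x : R) v : 0 <= x -> rnorm (of_real x *: v) = x * rnorm v.
Proof.
by move=> x0; rewrite rnormZ rnorm_real.
Qed.

Lemma closed_unit_ballP v : closed_unit_ball V v <-> rnorm v <= 1.
Proof. by rewrite /closed_unit_ball /= normE -of_real1 le_of_real. Qed.

Lemma open_unit_ballP v : open_unit_ball V v <-> rnorm v < 1.
Proof. by rewrite /open_unit_ball /= normE -of_real1 lt_of_real. Qed.

End rnorm.
End scalars.

(** * Finite nets in bounded sets of scalars *)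

Lemma real_net (R : realType) (M h : R) : 0 < h ->
  exists s : seq R, forall x, `|x| <= M -> exists2 y, y \in s & `|x - y| <= h.
Proof.
move=> h0; pose n := (Num.truncn (M / h)).+1.
exists [seq (i%:R - n%:R) * h | i <- iota 0 n.*2.+1] => x xM.
have Mn : M <= n%:R * h.
  by rewrite -ler_pdivrMr// ltW// truncnS_gt.
have y0 : 0 <= x / h + n%:R.
  have : - n%:R <= x / h; last by lra.
  by rewrite ler_pdivlMr// mulNr; move: xM; rewrite ler_norml; lra.
pose i := Num.truncn (x / h + n%:R).
have /andP[i1 i2] : i%:R <= x / h + n%:R < i.+1%:R by exact: truncn_itv.
exists ((i%:R - n%:R) * h).
  apply/mapP; exists i => //; rewrite mem_iota/= add0n ltnS -(ler_nat R).
  apply: le_trans i1 _; rewrite -addnn natrD lerD2r ler_pdivrMr//.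
  by move: xM; rewrite ler_norml; lra.
have -> : x - (i%:R - n%:R) * h = (x / h + n%:R - i%:R) * h.
  by rewrite !mulrDl mulfVK ?gt_eqF//; ring.
rewrite normrM (gtr0_norm h0) ler_piMl// ?(ltW h0)//.
by rewrite ger0_norm ?subr_ge0// -natr1 in i2 *; lra.
Qed.

(** Complex scalars are approximated coordinatewise to within [h / 2], which gives a total error of
    at most [h]. *)
Lemma scalar_net (R : realType) (k : scalar_kind) (M h : R) : 0 < h ->
  exists s : seq (scalars R k), forall t : (scalars R k)^o, rnorm t <= M ->
    exists2 u, u \in s & rnorm (t - u : (scalars R k)^o) <= h.
Proof.
move=> h0; case: k; first exact: real_net.
have h20 : 0 < h / 2 by lra.
have [s hs] := @real_net R M (h / 2) h20.
exists [seq (a +i* b)%C | a <- s, b <- s] => -[x y] xyM.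
have nE (z : R[i]) : rnorm (z : (scalars R ComplexScalars)^o)
    = Num.sqrt (complex.Re z ^+ 2 + complex.Im z ^+ 2).
  exact: (congr1 (@complex.Re R) (normc_def z)).
have le_sqrt (a b : R) : `|a| <= Num.sqrt (a ^+ 2 + b ^+ 2).
  by rewrite -sqrtr_sqr ler_sqrt ?addr_ge0 ?sqr_ge0// lerDl sqr_ge0.
move: xyM; rewrite nE /= => xyM.
have [u us xu] := hs x (le_trans (le_sqrt _ _) xyM).
have [v vs yv] : exists2 v, v \in s & `|y - v| <= h / 2.
  by apply: hs; apply: le_trans xyM; rewrite addrC le_sqrt.
exists (u +i* v)%C; first by apply/allpairsP; exists (u, v).
rewrite [leLHS](nE ((x +i* y) - (u +i* v))%C) /= -(@ger0_norm _ h) ?(ltW h0)//.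
rewrite -sqrtr_sqr ler_sqrt ?sqr_ge0//.
move: xu yv; rewrite !ler_norml => /andP[? ?] /andP[? ?]; nra.
Qed.

(** * Weak* continuity, convergence and closed balls *)

Section weak_star.
Context {R : realType} {k : scalar_kind} {X : normedModType (scalars R k)}.
Notation K := (scalars R k).
Implicit Types (f g h : dual X) (x : X).

Lemma rnorm_eval f x : rnorm (f x) <= rnorm f * rnorm x.
Proof. by rewrite -(@le_of_real R k) of_realM -!normE; exact: dual_norm_ub. Qed.

Lemma rnorm_dual_le f (M : R) :
  (forall x, rnorm (f x) <= M * rnorm x) -> 0 <= M -> rnorm f <= M.
Proof.
move=> fM M0; rewrite -(@le_of_real R k) -normE; apply: dual_norm_le => x.
rewrite normE -of_real1 le_of_real => x1.
rewrite normE le_of_real (le_trans (fM x))// ler_piMr//.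
Qed.

Lemma open_rnorm_lt (V : normedModType K) (c : V) (r : R) :
  open [set v | rnorm (v - c) < r].
Proof.
rewrite openE => v /= vr; apply/nbhs_normP.
exists (of_real (r - rnorm (v - c))).
  by rewrite /= -of_real0 lt_of_real subr_gt0.
move=> w; rewrite /= normE lt_of_real => vw.
by have := rnorm_dist_le v w c; lra.
Qed.

Lemma weak_star_eval_continuous x :
  continuous (fun f : weak_star X => (f : dual X) x).
Proof.
move=> f.
apply: (@continuous_comp (weak_star X) {ptws X -> K^o} K^o
  (fun g : dual X => dual_val g) (fun u => u x)).
  exact: initial_continuous.
have /pointwise_cvgP : {ptws, nbhs (dual_val f : {ptws X -> K^o}) --> dual_val f}.
  by apply: cvg_id.
exact.
Qed.

Lemma weak_star_cvg (F : set_system (weak_star X)) f : Filter F ->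
  (forall x, (g : dual X) x @[g --> F] --> (f x : K^o)) -> F --> (f : weak_star X).
Proof.
move=> FF Ff A [B [[C oC <-] Cf] CA]; apply: filterS CA _.
have FC : {ptws, dual_val (X := X) @ F --> dual_val f} by apply/pointwise_cvgP.
by apply: FC; exact: open_nbhs_nbhs.
Qed.

Lemma open_weak_star_ball x (c : K^o) (r : R) :
  open ([set f | rnorm (f x - c) < r] : set (weak_star X)).
Proof.
apply: (@open_comp (weak_star X) K^o (fun f : dual X => f x)
    [set z : K^o | rnorm (z - c) < r]).
  by move=> f _; exact: weak_star_eval_continuous.
exact: open_rnorm_lt.
Qed.

Lemma weak_star_closure_approx (A : set (dual X)) f x (e : R) :
  weak_star_closure A f -> 0 < e -> exists2 g, A g & rnorm (g x - f x) < e.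
Proof.
move=> Af e0.
have [|g [Ag gf]] := Af [set g : dual X | rnorm (g x - f x) < e].
  apply: open_nbhs_nbhs; split; first exact: open_weak_star_ball.
  by rewrite /= subrr rnorm0.
by exists g.
Qed.

(** This is weak* lower semicontinuity of the norm: at each [x], the value of [f] is approximated by
    values of elements of the ball, with arbitrarily small error. *)
Lemma closed_weak_star_ball g (r : R) :
  closed ([set f | rnorm (f - g) <= r] : set (weak_star X)).
Proof.
move=> f fr.
(* A negative radius would give an empty ball, which has no closure points. *)
have r0 : 0 <= r.
  have [|h /= hr _] := @weak_star_closure_approx _ _ 0 1 fr => //.
  exact: le_trans (rnorm_ge0 _) hr.
apply: rnorm_dual_le => // x; apply/ler_addgt0Pl => e e0.
have [h hr fh] := weak_star_closure_approx _ _ x _ fr e0.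
have hg : rnorm (h x - g x) <= r * rnorm x.
  by apply: le_trans (rnorm_eval (h - g) x) _; rewrite ler_wpM2r// rnorm_ge0.
apply: (@le_trans _ _ (rnorm (h x - g x) + rnorm (h x - f x))).
  exact: (rnorm_dist_le (h x : K^o) (f x : K^o) (g x : K^o)).
by lra.
Qed.
End weak_star.

(** * Greedy choice of points far from all earlier lines *)

Section selection.
Context {R : realType} {k : scalar_kind}.
Notation K := (scalars R k).

Lemma diameter_le (V : normedModType K) (A : set V) (c : V) (r : R) :
  A !=set0 -> (forall v, A v -> rnorm (v - c) <= r) ->
  diameter A <= of_real (2 * r).
Proof.
move=> [a Aa] Ar.
have Ab : ubound [set `|x - y| | x in A & y in A] (of_real (2 * r)).
  move=> _ [x Ax [y Ay <-]]; rewrite normE le_of_real.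
  have := rnorm_dist_le c x y; rewrite !(rnorm_distrC c).
  by have := Ar _ Ax; have := Ar _ Ay; lra.
(* The point [a] and the bound [Ab] exclude the default value of [supremum]. *)
have [_] : supremums [set `|x - y| | x in A & y in A] (diameter A).
  apply: scalars_supremumP.
  - by move=> _ [x Ax [y Ay <-]] /=.
  - by exists (of_real (2 * r)).
  - by exists `|a - a|, a => //; exists a.
exact.
Qed.

(** Replacing the coefficient [t] by the net point [u] moves the multiple of [y] by at most [delta].
    With the next lemma, which handles large coefficients, this reduces avoiding a line to avoiding
    finitely many balls. *)
Lemma far_from_near_multiple (V : normedModType K) (f y : V) (t u : K^o) (delta : R) :
  0 < delta -> 2 * delta < rnorm (f - u *: y) ->
  rnorm (t - u) <= delta / (1 + rnorm y) -> delta <= rnorm (f - t *: y).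
Proof.
move=> d0 fu tu; have y0 := rnorm_ge0 y.
have := rnorm_dist_le (t *: y) f (u *: y).
rewrite -scalerBl rnormZ (rnorm_distrC _ f).
have : rnorm (t - u) * rnorm y <= delta; last by lra.
apply: (@le_trans _ _ (delta / (1 + rnorm y) * rnorm y)); first by rewrite ler_wpM2r.
by rewrite mulrAC ler_pdivrMr ?ler_pM2l//; lra.
Qed.

Lemma far_from_large_multiple (V : normedModType K) (f y : V) (t : K^o) (delta : R) :
  rnorm f <= 1 -> 0 < rnorm y -> (1 + delta) / rnorm y < rnorm t ->
  delta <= rnorm (f - t *: y).
Proof.
move=> f1 y0; rewrite ltr_pdivrMr// -rnormZ => /ltW ty.
by have := rnorm_split f (t *: y); rewrite (rnorm_distrC _ f); lra.
Qed.

Context {X : normedModType K}.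
Context {eps : R}.
Hypothesis diam_ge : forall W : set (weak_star X), open W ->
  closed_unit_ball (dual X) `&` W !=set0 ->
  of_real eps <= diameter (closed_unit_ball (dual X) `&` W).

(** Balls are removed one at a time. Each is weak* closed, so [W] stays open; if one contained the
    whole relatively open set, the diameter would be at most [2 * r < eps]. *)
Lemma avoid_balls (r : R) (cs : seq (dual X)) (W : set (weak_star X)) :
  2 * r < eps -> open W -> closed_unit_ball (dual X) `&` W !=set0 ->
  exists2 f : dual X, (closed_unit_ball (dual X) `&` W) f &
    forall c, c \in cs -> r < rnorm (f - c).
Proof.
move=> reps; elim: cs W => [|c cs IH] W oW W0.
  by have [f Wf] := W0; exists f.
pose B : set (weak_star X) := [set f : dual X | rnorm (f - c) <= r].
have [f [Df [Wf nBf]]] : closed_unit_ball (dual X) `&` (W `&` ~` B) !=set0.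
  apply: contrapT => /set0P/negP/negPn/eqP WB.
  suff /(le_trans (diam_ge _ oW W0)) : diameter (closed_unit_ball (dual X) `&` W)
      <= of_real (2 * r) by rewrite le_of_real; lra.
  apply: (@diameter_le _ _ c) => // v [Dv Wv]; apply: contrapT => nB.
  by have : set0 v by rewrite -WB.
have [||g [Dg [Wg nBg]] gcs] := IH (W `&` ~` B); [|by exists f|].
  apply: openI => //; apply: closed_openC; exact: closed_weak_star_ball.
exists g => // d; rewrite inE => /predU1P[->|/gcs//].
by rewrite ltNge; apply/negP.
Qed.

Lemma avoid_lines (delta : R) (ys : seq (dual X)) (W : set (weak_star X)) :
  0 < delta -> 4 * delta < eps -> open W ->
  closed_unit_ball (dual X) `&` W !=set0 ->
  exists2 f : dual X, (closed_unit_ball (dual X) `&` W) f & delta <= rnorm f /\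
    forall y (t : K), y \in ys -> delta <= rnorm (f - t *: y).
Proof.
move=> d0 deps oW W0.
have hy (y : dual X) : 0 < delta / (1 + rnorm y).
  by rewrite divr_gt0// ltr_pwDl// rnorm_ge0.
have /choice[net netP] (y : dual X) : exists s : seq K, forall t : K^o,
    rnorm t <= (1 + delta) / rnorm y ->
    exists2 u, u \in s & rnorm (t - u : K^o) <= delta / (1 + rnorm y).
  exact: scalar_net.
(* The centre 0 keeps [f] away from 0; the others are net points on the bounded part of each line.
   The radius [2 * delta] leaves room for the net error. *)
have [|f [/= f1 Wf] fcs] := @avoid_balls (2 * delta)
  (0 :: flatten [seq [seq u *: y | u <- net y] | y <- ys]) W _ oW W0; first by lra.
have f2 : 2 * delta < rnorm f by rewrite -[f]subr0; apply: fcs; rewrite inE eqxx.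
have fd : delta <= rnorm f by rewrite (le_trans _ (ltW f2))//; lra.
exists f => //; split=> // y t yys.
have [->|y0] := eqVneq y 0; first by rewrite scaler0 subr0.
have {y0} y0 : 0 < rnorm y by rewrite lt_def rnorm_ge0 rnorm_eq0 y0.
have [tM|] := leP (rnorm (t : K^o)) ((1 + delta) / rnorm y).
  have [u uy tu] := netP y t tM.
  have fu : 2 * delta < rnorm (f - u *: y).
    apply: fcs; rewrite inE; apply/orP; right; apply/flattenP.
    by exists [seq u *: y | u <- net y]; apply/mapP; [exists y|exists u].
  exact: far_from_near_multiple tu.
by apply: far_from_large_multiple => //; exact/closed_unit_ballP.
Qed.

Lemma separated_sequence (delta : R) (W : nat -> set (weak_star X)) :
  0 < delta -> 4 * delta < eps -> (forall n, open (W n)) ->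
  exists x : nat -> dual X,
    [/\ forall n, rnorm (x n) <= 1, forall n, delta <= rnorm (x n),
        forall m n (t : K), (m < n)%N -> delta <= rnorm (x n - t *: x m) &
        forall n, closed_unit_ball (dual X) `&` W n !=set0 -> W n (x n)].
Proof.
move=> d0 deps oW.
have /choice[sel selP] (p : nat * seq (dual X)) : exists f : dual X,
    [/\ closed_unit_ball (dual X) f, delta <= rnorm f,
        forall y (t : K), y \in p.2 -> delta <= rnorm (f - t *: y) &
        closed_unit_ball (dual X) `&` W p.1 !=set0 -> W p.1 f].
  case: p => n ys /=.
  have [W0|W0] := pselect (closed_unit_ball (dual X) `&` W n !=set0).
    by have [f [f1 Wf] [f2 fy]] := avoid_lines _ ys _ d0 deps (oW n) W0; exists f.
  (* If [W n] misses the dual ball, the whole space takes its place. *)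
  have [|f [f1 _] [f2 fy]] := avoid_lines _ ys _ d0 deps openT.
    by exists 0; split=> //; apply/closed_unit_ballP; rewrite rnorm0.
  by exists f; split => // /W0.
(* [hist n] lists the points chosen before stage [n], latest first. *)
pose fix hist n := if n is m.+1 then sel (m, hist m) :: hist m else [::].
exists (fun n => sel (n, hist n)); split=> [n|n|m n t mn|n].
- by have [/closed_unit_ballP] := selP (n, hist n).
- by have [] := selP (n, hist n).
- have [_ _ /(_ (sel (m, hist m)) t) + _] := selP (n, hist n); apply.
  elim: n mn => //= n IH; rewrite ltnS leq_eqVlt inE => /predU1P[->|/IH ->].
    by rewrite eqxx.
  by rewrite orbT.
- by have [_ _ _ +] := selP (n, hist n); apply.
Qed.

End selection.

(** * Countable bases and weak* approximation by sequences *)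

Section countable_base.
Context {R : realType} {k : scalar_kind}.
Notation K := (scalars R k).

Lemma scalars_dense_sequence :
  exists e : nat -> K, forall (t : K^o) (h : R), 0 < h -> exists n, rnorm (t - e n) < h.
Proof.
have /choice[s sP] (n : nat) : exists s : seq K, forall t : K^o, rnorm t <= n%:R ->
    exists2 u, u \in s & rnorm (t - u : K^o) <= n.+1%:R^-1.
  by apply: scalar_net; rewrite invr_gt0.
exists (fun p => if unpickle p is Some q then nth 0 (s q.1) q.2 else 0) => t h h0.
(* This [n] controls both range and mesh: [rnorm t < n] and [1 / (n + 1) < h]. *)
pose n := (Num.truncn (rnorm t + h^-1)).+1.
have tn : rnorm t + h^-1 < n%:R by exact: truncnS_gt.
have h'0 : 0 < h^-1 by rewrite invr_gt0.
have [|u us tu] := sP n t; first by lra.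
exists (pickle (n, index u (s n))); rewrite pickleK /= nth_index//.
apply: le_lt_trans tu _; rewrite invf_plt ?posrE// -natr1.
by have := rnorm_ge0 t; lra.
Qed.

Context {X : normedModType K}.

Lemma separable_dense_sequence : separable X ->
  exists a : nat -> X, forall x (h : R), 0 < h -> exists n, rnorm (x - a n) < h.
Proof.
move=> [S /countable_injP[phi phi_inj] Sd].
exists (fun n => xget 0 [set x | S x /\ phi x = n]) => x h h0.
have [||y [/= yx Sy]] := Sd [set y | rnorm (y - x) < h].
- by exists x; rewrite /= subrr rnorm0.
- exact: open_rnorm_lt.
exists (phi y); case: xgetP => [z _ [Sz /phi_inj zy]|/(_ y)]; last by case.
by rewrite zy ?inE// rnorm_distrC.
Qed.

(* The sets [W n] play the role of a base of the weak* topology of the dual ball,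
   which is all that is needed of its metrizability. *)
Lemma weak_star_ball_base : separable X ->
  exists W : nat -> set (weak_star X), (forall n, open (W n)) /\
    forall f : dual X, rnorm f <= 1 -> exists m : nat -> nat,
      (forall j, W (m j) f) /\
      forall g : nat -> dual X,
        (forall j, rnorm (g j) <= 1) -> (forall j, W (m j) (g j)) ->
        forall x (h : R), 0 < h -> \forall j \near \oo, rnorm (g j x - f x) < h.
Proof.
move=> /separable_dense_sequence[a aP].
have [e eP] := scalars_dense_sequence.
(* The values at the first [j] points of the dense sequence are prescribed up to [1 / (j + 1)]. The
   prescription is coded by a finite sequence of naturals, so the family is countable. *)
pose N (j : nat) (q : seq nat) : set (weak_star X) := [set f : dual X | forall i,
  (i < j)%N -> rnorm (f (a i) - e (nth 0%N q i)) < j.+1%:R^-1].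
have oN j q : open (N j q).
  (* The tolerance must stay fixed while the induction varies the number of tested points. *)
  rewrite /N; move: (j.+1%:R^-1) => h.
  elim: j => [|j IH].
    rewrite (_ : mkset _ = setT); first exact: openT.
    by apply/seteqP; split.
  rewrite [X in open X](_ : _ = [set f : dual X | rnorm (f (a j) - e (nth 0%N q j)) < h]
    `&` [set f : dual X | forall i, (i < j)%N -> rnorm (f (a i) - e (nth 0%N q i)) < h]).
    by apply: openI => //; exact: open_weak_star_ball.
  apply/seteqP; split=> f /=.
    by move=> fi; split=> [|i ij]; apply: fi => //; exact: ltnW.
  by move=> [fj fi] i; rewrite ltnS leq_eqVlt => /predU1P[->//|]; exact: fi.
exists (fun n => if unpickle n is Some p then N p.1 p.2 else setT); split.
  by move=> n; case: unpickle => [p|]; [exact: oN|exact: openT].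
move=> f f1.
have /choice[q qP] (j : nat) : exists q, N j q f.
  have /choice[q qP] (i : nat) : exists n, rnorm (f (a i) - e n) < j.+1%:R^-1.
    by apply: eP; rewrite invr_gt0.
  by exists (mkseq q j) => i ij; rewrite nth_mkseq.
exists (fun j => pickle (j, q j)); split=> [j|g g1 gN x h h0].
  by rewrite pickleK /=; exact: qP.
have [|i xi] := aP x (h / 4); first by lra.
pose n := (Num.truncn (4 / h)).+1.
have h'0 : 0 < 4 / h by rewrite divr_gt0.
have n4 : 4 / h < n%:R by exact: truncnS_gt.
exists (maxn i.+1 n) => // j mj.
have /andP[ij nj] : (i < j)%N && (n <= j)%N by rewrite -geq_max.
have jh : j.+1%:R^-1 < h / 4.
  rewrite invf_plt ?posrE ?divr_gt0// invf_div (lt_le_trans n4)// ler_nat.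
  exact: leq_trans nj _.
have := gN j; rewrite pickleK /= => /(_ _ ij) gi.
have fi := qP j _ ij.
(* A functional of norm at most 1 changes by less than [h / 4] between [x] and [a i]. *)
have small (p : dual X) : rnorm p <= 1 -> rnorm (p x - p (a i)) < h / 4.
  move=> p1; rewrite -linearB; apply: le_lt_trans (rnorm_eval _ _) _.
  by apply: le_lt_trans xi; rewrite ler_piMl// rnorm_ge0.
apply: (@rnorm_dist_lt4 _ _ K^o h (e (nth 0%N (q j) i)) _ (g j (a i)) _ (f (a i))).
- exact: small.
- exact: small.
- exact: lt_trans gi jh.
- exact: lt_trans fi jh.
Qed.

Lemma weak_star_closure_cvg (A : set (dual X)) (g : nat -> dual X) (f : dual X) :
  (forall j, A (g j)) ->
  (forall x (h : R), 0 < h -> \forall j \near \oo, rnorm (g j x - f x) < h) ->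
  weak_star_closure A f.
Proof.
move=> gA gf B Bf.
have gcvg : (fun j => g j : weak_star X) @ \oo --> (f : weak_star X).
  apply: weak_star_cvg => x; apply/cvgrPdist_lt => /= _ /gt0_of_real[h h0 ->].
  by apply: filterS (gf x h h0) => j; rewrite -(@lt_of_real _ k) -normE distrC.
have [j _ Bj] := gcvg _ Bf.
by exists (g j); split => //; exact: Bj (leqnn j).
Qed.

(** The points [g j] may have norm 1 and thus lie outside a subset of the open ball; factors below 1
    and tending to 1 bring them inside and keep the limit. *)
Lemma weak_star_closure_multiples (A : set (dual X)) (g : nat -> dual X) (f : dual X) :
  (forall j, rnorm (g j) <= 1) ->
  (forall j (c : R), 0 <= c -> c < 1 -> A (of_real c *: g j)) ->
  (forall x (h : R), 0 < h -> \forall j \near \oo, rnorm (g j x - f x) < h) ->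
  weak_star_closure A f.
Proof.
move=> g1 gA gf; pose c j : R := 1 - j.+2%:R^-1.
apply: (@weak_star_closure_cvg _ (fun j => of_real (c j) *: g j)) => [j|x h h0].
  apply: gA; first by rewrite subr_ge0 invf_le1 ?ltr0n// ler1n.
  by rewrite ltrBlDr ltrDl invr_gt0 ltr0n.
have h20 : 0 < h / 2 by lra.
pose n := Num.truncn (rnorm x / (h / 2)).
have nx : rnorm x / (h / 2) < n.+1%:R by exact: truncnS_gt.
apply: filterS2 (nbhs_infty_ge n) (gf x _ h20) => j nj gfj.
rewrite [(_ *: g j) x]/(of_real (c j) *: g j x).
apply: le_lt_trans (rnorm_dist_le (g j x) _ _) _.
have -> : g j x - of_real (c j) *: g j x = of_real j.+2%:R^-1 *: g j x.
  have {1}-> : g j x = of_real (c j + j.+2%:R^-1) *: g j x.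
    by rewrite /c subrK of_real1 scale1r.
  by rewrite of_realD scalerDl addrC addKr.
rewrite rnorm_of_real ?invr_ge0// (splitr h) ltrD//.
rewrite mulrC ltr_pdivrMr// (le_lt_trans (rnorm_eval _ _))//.
apply: (@le_lt_trans _ _ (rnorm x)); first by rewrite ler_piMl ?rnorm_ge0.
move: nx; rewrite ltr_pdivrMr// mulrC => /lt_le_trans; apply.
by rewrite ler_pM2l// ler_nat ltnS (leq_trans nj).
Qed.

End countable_base.

(** * Geometry of the tubes around the lines *)

Section tubes.
Context {R : realType} {k : scalar_kind}.
Notation K := (scalars R k).
Context {V : normedModType K}.
Context {x : nat -> V} {delta q r : R}.
Hypothesis delta_gt0 : 0 < delta.
Hypothesis x_le1 : forall n, rnorm (x n) <= 1.
Hypothesis x_ge : forall n, delta <= rnorm (x n).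
Hypothesis x_sep : forall m n (t : K), (m < n)%N -> delta <= rnorm (x n - t *: x m).
Hypothesis q_gt0 : 0 < q.
Hypothesis q_r : 4 * q * (1 + 2 / delta) <= r.
Hypothesis r_delta : r < delta / 2.

Definition tube (n : nat) : set V :=
  [set z | rnorm z < 1 /\ exists t : K, rnorm (z - t *: x n) < q / n.+1%:R].

(** All the lines meet at 0; the ball of radius [r] absorbs the region where distinct tubes can
    overlap. *)
Definition tubes : set V := [set z | rnorm z < r] `|` \bigcup_n tube n.

Let delta_le1 : delta <= 1.
Proof. exact: le_trans (x_ge 0) (x_le1 0). Qed.

Let q4_r : 4 * q <= r.
Proof.
have d0 : 0 <= 2 / delta by rewrite divr_ge0// ltW.
by have := mulr_ge0 (ltW q_gt0) d0; move: q_r; lra.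
Qed.

Lemma radius_le n : q / n.+1%:R <= q.
Proof. by rewrite ler_pdivrMr// ler_peMr ?(ltW q_gt0)// ler1n. Qed.

Lemma multiples_sep m n (s t : K) : (m < n)%N ->
  rnorm (s : K^o) * delta <= rnorm (s *: x n - t *: x m).
Proof.
move=> mn; have [->|s0] := eqVneq s 0; first by rewrite rnorm0 mul0r rnorm_ge0.
have -> : s *: x n - t *: x m = s *: (x n - (s^-1 * t) *: x m).
  by rewrite scalerBr scalerA mulrA divff// mul1r.
by rewrite [leRHS]rnormZ ler_wpM2l ?rnorm_ge0// x_sep.
Qed.

(** Let [n] be the later index. Then [s *: x n] is within [2 * h] of a multiple of [x m], so
    separation gives [rnorm s < 2 * h / delta], and [z] is within [h] of [s *: x n]. *)
Lemma near_two_lines m n (s t : K) z (h : R) : m != n ->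
  rnorm (z - s *: x n) < h -> rnorm (z - t *: x m) < h ->
  rnorm z < h * (1 + 2 / delta).
Proof.
wlog mn : m n s t / (m < n)%N => [H|].
  rewrite neq_ltn => /orP[mn|nm] zs zt.
    by apply: (H m n s t) => //; rewrite ltn_eqF.
  by apply: (H n m t s) => //; rewrite ltn_eqF.
move=> _ zs zt.
have sd : rnorm (s : K^o) * delta < 2 * h.
  apply: le_lt_trans (multiples_sep m n s t mn) _.
  by have := rnorm_dist_le z (s *: x n) (t *: x m); lra.
have : rnorm z < h + rnorm (s : K^o).
  have := rnorm_split (s *: x n) z; rewrite rnormZ.
  have : rnorm (s : K^o) * rnorm (x n) <= rnorm (s : K^o).
    by rewrite ler_piMr ?rnorm_ge0.
  lra.
move=> /lt_trans; apply; rewrite mulrDr mulr1 ltrD2l.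
by rewrite mulrA ltr_pdivlMr// mulrC [X in _ < X]mulrC mulrC.
Qed.

Lemma tubes_lt1 z : tubes z -> rnorm z < 1.
Proof. by case=> [/= zr|[n _ []]//]; move: r_delta delta_le1; lra. Qed.

Lemma tubes_outside_ball z : tubes z -> r < rnorm z -> exists n, tube n z.
Proof. by case=> [/= + /ltW|[n _ zn]]; [rewrite ltNge => /negP|exists n]. Qed.

(** The dilation of [z] by [1 + d / 2] stays in [tubes], so undoing it puts [z] in a shrunken tube
    unless [z] is near the central ball. A further move along [x n.+1] stays in the same tube, which
    is therefore not too thin; this bounds [n]. *)
Lemma scaled_tubes z (d : R) : 0 < d -> d <= 1 ->
  (forall w, rnorm (w - z) <= d -> tubes w) ->
  rnorm z <= (1 + d / 2)^-1 /\
  (rnorm z <= r * (1 - d / 4) \/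
   exists n, n.+1%:R < 16 / (d * delta) /\
     exists t : K, rnorm (z - t *: x n) <= (1 + d / 2)^-1 * (q / n.+1%:R)).
Proof.
move=> d0 d1 zd.
have zU : tubes z by apply: zd; rewrite subrr rnorm0 ltW.
have z1 := tubes_lt1 _ zU.
have z0 := rnorm_ge0 z.
have a0 : 0 < 1 + d / 2 by lra.
pose a : K := of_real (1 + d / 2).
have an : a != 0 by rewrite gt_eqF// -of_real0 lt_of_real.
have az : a *: z - z = of_real (d / 2) *: z.
  by rewrite /a of_realD of_real1 scalerDl scale1r addrC addKr.
have d20 : 0 <= d / 2 by lra.
have azn : rnorm (a *: z) = (1 + d / 2) * rnorm z by rewrite rnorm_of_real// ltW.
have azz : rnorm (a *: z - z) <= d / 2.
  by rewrite az rnorm_of_real// ler_piMr// ltW.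
have azU : tubes (a *: z) by apply: zd; lra.
split.
  by rewrite -[leRHS]mul1r ler_pdivlMr// mulrC -azn ltW// tubes_lt1.
have [|zr] := leP (rnorm z) (r * (1 - d / 4)); first by left.
right.
(* The step [e] is small against [d], to stay in the ball around [z]; against [r * d], to stay
   outside the central ball; and against [q], to stay close to the same line. *)
pose e := q * d / 8.
have e0 : 0 < e by rewrite /e divr_gt0// mulr_gt0.
have eq8 : e <= q / 8 by rewrite /e ler_pM2r// ler_piMr// ltW.
have ed : e <= d / 8.
  by rewrite /e ler_pM2r// ler_piMl ?ltW//; move: q4_r r_delta delta_le1; lra.
have r0 : 0 < r by move: q4_r; lra.
have azr : r + r * d / 8 <= rnorm (a *: z).
  rewrite azn; apply: (@le_trans _ _ ((1 + d / 2) * (r * (1 - d / 4)))); last first.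
    by rewrite ler_pM2l// ltW.
  have := mulr_ge0 (ltW r0) (ltW d0); nra.
have er : e < r * d / 8 by rewrite /e ltr_pM2r// ltr_pM2r//; move: q4_r; lra.
have [|n [_ [s zs]]] := tubes_outside_ball _ azU; first lra.
pose w := a *: z + of_real e *: x n.+1.
have wz : rnorm (w - a *: z) <= e.
  by rewrite /w addrC addKr rnorm_of_real ?(ltW e0)// ler_piMr// ltW.
have wr : r < rnorm w.
  by have := rnorm_split w (a *: z); rewrite rnorm_distrC; lra.
have [|m [_ [t wt]]] := tubes_outside_ball w _ wr.
  apply: zd; have := rnorm_dist_le (a *: z) w z.
  by rewrite (rnorm_distrC _ w); lra.
have q1 := radius_le n; have q2 := radius_le m.
(* Otherwise [a *: z] would be within [2 * q] of two lines, hence of norm below [r / 2]. *)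
have mn : m = n.
  apply/eqP/contraT => mn.
  have zt := rnorm_dist_le w (a *: z) (t *: x m).
  have q2q : q <= 2 * q by move: q_gt0; lra.
  have zs2 := lt_le_trans zs (le_trans q1 q2q).
  have zt2 : rnorm (a *: z - t *: x m) < 2 * q.
    by have := lt_le_trans wt q2; move: q_gt0; lra.
  have := near_two_lines m n s t (a *: z) _ mn zs2 zt2.
  have rd : 0 < r * d by rewrite mulr_gt0.
  by move: q_r; lra.
subst m.
exists n; split; last first.
  exists (a^-1 * s).
  rewrite ler_pdivlMl// -rnorm_of_real ?(ltW a0)//.
  by rewrite scalerBr !scalerA mulrA divff// mul1r ltW.
(* As [a *: z] and [w] lie in the same tube, their difference [e *: x n.+1] is within
   [2 * q / (n + 1)] of the line through [x n]. *)
have := multiples_sep n n.+1 (of_real e) (t - s) (ltnSn n).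
have -> : of_real e *: x n.+1 - (t - s) *: x n = (w - t *: x n) - (a *: z - s *: x n).
  rewrite /w scalerBl !opprB [a *: z + _]addrC -!addrA; congr (_ + _).
  by rewrite (addrA (- _)) [RHS]addrC subrK addrC.
rewrite rnorm_real ?(ltW e0)// => ew.
have wzn := rnormB (w - t *: x n) (a *: z - s *: x n).
have : e * delta < 2 * (q / n.+1%:R).
  apply: le_lt_trans ew (le_lt_trans wzn _).
  by rewrite mulr_natl mulr2n ltrD.
have n0 : 0 < n.+1%:R :> R by rewrite ltr0n.
have dd : 0 < d * delta by rewrite mulr_gt0.
rewrite mulrA ltr_pdivlMr// ltr_pdivlMr// => H.
by rewrite -(ltr_pM2l q_gt0); rewrite /e in H; lra.
Qed.

(** Coefficients of points near the line are bounded by [2 / delta], so a finite net of them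
    suffices. The radius [h] is midway between those of the shrunken and the full tube; the bound
    [c] on the norm keeps the points inside the open unit ball. *)
Lemma tube_cover n (c : R) : 0 < c -> c < 1 ->
  exists us : seq V, exists2 h : R,
    (forall z, rnorm z <= c ->
      (exists t : K, rnorm (z - t *: x n) <= c * (q / n.+1%:R)) ->
      exists2 u, u \in us & rnorm (z - u) <= h) &
    forall z u, rnorm z <= c -> u \in us -> rnorm (z - u) <= h -> tube n z.
Proof.
move=> c0 c1; set rad := q / n.+1%:R.
have rad0 : 0 < rad by rewrite divr_gt0.
have rad1 : rad <= 1.
  by apply: le_trans (radius_le n) _; move: q4_r r_delta delta_le1 q_gt0; lra.
have crad : c * rad < rad by rewrite gtr_pMl.
have [|us usP] := @scalar_net R k (2 / delta) ((rad - c * rad) / 2); first by lra.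
exists [seq u *: x n | u <- us]; exists ((rad + c * rad) / 2)
  => [z zc [t zt]|z _ zc /mapP[u _ ->] zu].
  have [|u uus tu] := usP t.
    rewrite ler_pdivlMr//; apply: (@le_trans _ _ (rnorm (t *: x n))).
      by rewrite rnormZ ler_wpM2l// rnorm_ge0.
    by have := rnorm_split z (t *: x n); rewrite (rnorm_distrC _ z); lra.
  exists (u *: x n); first by apply/mapP; exists u.
  have tux : rnorm ((t - u) *: x n) <= (rad - c * rad) / 2.
    by rewrite rnormZ (le_trans _ tu)// ler_piMr ?rnorm_ge0.
  by have := rnorm_dist_le (t *: x n) z (u *: x n); rewrite (rnorm_distrC _ z) -scalerBl; lra.
split; first exact: le_lt_trans zc c1.
by exists u; apply: le_lt_trans zu _; rewrite ltr_pdivrMr// mulr_natr mulr2n ltrD2l.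
Qed.

(** The bound on tube indices in [scaled_tubes] leaves finitely many tubes, each covered by
    [tube_cover], together with one ball around 0. *)
Lemma tubes_cover (d : R) : 0 < d -> d <= 1 ->
  exists2 c : R, c < 1 & exists2 bs : seq (V * R),
    (forall z, (forall w, rnorm (w - z) <= d -> tubes w) ->
      rnorm z <= c /\ exists2 b, b \in bs & rnorm (z - b.1) <= b.2) &
    forall z b, rnorm z <= c -> b \in bs -> rnorm (z - b.1) <= b.2 -> tubes z.
Proof.
move=> d0 d1; pose c := (1 + d / 2)^-1.
have c0 : 0 < c by rewrite invr_gt0; lra.
have c1 : c < 1 by rewrite invf_lt1; lra.
have /choice[us usP] (n : nat) := tube_cover n c c0 c1.
have /choice[h hP] (n : nat) : exists h : R,
    (forall z, rnorm z <= c ->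
      (exists t : K, rnorm (z - t *: x n) <= c * (q / n.+1%:R)) ->
      exists2 u, u \in us n & rnorm (z - u) <= h) /\
    forall z u, rnorm z <= c -> u \in us n -> rnorm (z - u) <= h -> tube n z.
  by have [h] := usP n; exists h.
pose N := (Num.truncn (16 / (d * delta))).+1.
exists c => //; exists ((0, r * (1 - d / 4)) ::
  flatten [seq [seq (u, h n) | u <- us n] | n <- iota 0 N]).
  move=> z /(scaled_tubes z d d0 d1)[zc zt]; split => //.
  case: zt => [zr|[n [nN zt]]].
    by exists (0, r * (1 - d / 4)); rewrite ?inE ?eqxx// subr0.
  have [u uus zu] := (hP n).1 z zc zt.
  exists (u, h n) => //; rewrite inE; apply/orP; right; apply/flattenP.
  exists [seq (u, h n) | u <- us n]; last by apply/mapP; exists u.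
  apply/mapP; exists n => //; rewrite mem_iota /= add0n -(ltr_nat R).
  by rewrite (lt_trans _ (lt_trans nN (truncnS_gt _)))// ltr_nat.
move=> z b zc; rewrite inE => /predU1P[->|/flattenP[_ /mapP[n _ ->] /mapP[u uus ->]]] /=.
  rewrite subr0 => zr; left => /=; apply: le_lt_trans zr _.
  by rewrite gtr_pMr; move: q4_r q_gt0; lra.
by move=> zu; right; exists n => //; exact: (hP n).2 zu.
Qed.

(** Half of a late [x n] has a margin of 1/4 in the unit ball. Were that ball contained in [tubes],
    this point would lie near 0 or in a tube of index below [n], but it is at distance at least
    [delta / 2] from 0 and from all earlier lines. *)
Lemma tubes_proper : ~ (open_unit_ball V `<=` tubes).
Proof.
move=> BU; pose n := (Num.truncn (16 / (4^-1 * delta))).+1.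
pose z := of_real (1 / 2) *: x n.
have z_sep m (t : K) : (m < n)%N -> delta / 2 <= rnorm (z - t *: x m).
  move=> mn; have := multiples_sep m n (of_real (1 / 2)) t mn.
  by rewrite rnorm_real; lra.
have zn : rnorm z = rnorm (x n) / 2 by rewrite rnorm_of_real; lra.
have [|||_] := scaled_tubes z 4^-1; [lra|lra| |].
  move=> w wz; apply: BU; apply/open_unit_ballP.
  by have := rnorm_split z w; have := x_le1 n; lra.
case=> [zr|[m [mn [t zt]]]].
  have r0 : 0 < r by move: q4_r q_gt0; lra.
  by have := x_ge n; move: r_delta; lra.
have mn' : (m < n)%N.
  by rewrite -(ltr_nat R) (lt_trans _ (lt_trans mn (truncnS_gt _)))// ltr_nat.
have := z_sep m t mn'; rewrite leNgt => /negP; apply; apply: le_lt_trans zt _.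
apply: (@le_lt_trans _ _ q); last by move: q4_r q_gt0 r_delta; lra.
apply: le_trans (radius_le m); rewrite ler_piMl ?divr_ge0 ?(ltW q_gt0)//.
by rewrite invf_le1; lra.
Qed.

Lemma tubes_balanced : balanced tubes.
Proof.
move=> t; rewrite -[`|t|]/(`|t : K^o|) normE -of_real1 le_of_real => t1.
have tz z : rnorm (t *: z) <= rnorm z by rewrite rnormZ ler_piMl ?rnorm_ge0.
move=> _ [z [zr|[n _ [z1 [s zs]]]] <-].
  by left; exact: le_lt_trans zr.
right; exists n => //; split; first exact: le_lt_trans z1.
by exists (t * s); rewrite -scalerA -scalerBr; exact: le_lt_trans zs.
Qed.

Lemma open_tubes : open tubes.
Proof.
have o1 (c : R) : open [set z : V | rnorm z < c].
  by have := open_rnorm_lt V 0 c; under eq_set do rewrite subr0.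
apply: openU => //; apply: bigcup_open => n _.
rewrite (_ : tube n = [set z | rnorm z < 1] `&`
    \bigcup_t [set z | rnorm (z - t *: x n) < q / n.+1%:R]).
  by apply: openI => //; apply: bigcup_open => t _; exact: open_rnorm_lt.
by apply/seteqP; split=> z [z1 [t]]; [split=> //; exists t|split=> //; exists t].
Qed.

Lemma multiple_in_tubes n (c : R) : 0 <= c -> c < 1 -> tubes (of_real c *: x n).
Proof.
move=> c0 c1; right; exists n => //; split.
  by rewrite rnorm_of_real//; apply: le_lt_trans c1; rewrite ler_piMr.
by exists (of_real c); rewrite subrr rnorm0 divr_gt0.
Qed.

End tubes.

(** * Envelopes and conclusion *)

Section envelope.
Context {R : realType} {k : scalar_kind} {X : normedModType (scalars R k)}.

Lemma weak_star_closure_balls (A : set (dual X)) (bs : seq (dual X * R)) :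
  (forall f, A f -> exists2 b, b \in bs & rnorm (f - b.1) <= b.2) ->
  forall f, weak_star_closure A f -> exists2 b, b \in bs & rnorm (f - b.1) <= b.2.
Proof.
move=> Abs.
suff cB : closed ([set f | exists2 b, b \in bs & rnorm (f - b.1) <= b.2] :
    set (weak_star X)).
  by move=> f Af; apply: cB; apply: closure_subset Af => g; exact: Abs.
elim: bs {Abs} => [|b bs IH].
  rewrite [X in closed X](_ : _ = set0); first exact: closed0.
  by apply/seteqP; split=> // f [].
rewrite [X in closed X](_ : _ = [set f : dual X | rnorm (f - b.1) <= b.2] `|`
    [set f : dual X | exists2 b, b \in bs & rnorm (f - b.1) <= b.2]).
  by apply: closedU => //; exact: closed_weak_star_ball.
apply/seteqP; split=> f.
  by move=> [c]; rewrite inE => /predU1P[->|cbs] fc; [left|right; exists c].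
by case=> [fb|[c cbs fc]]; [exists b|exists c] => //; rewrite inE ?eqxx// cbs orbT.
Qed.

Lemma U_bounded_margin (V : normedModType (scalars R k)) (U B : set V) :
  U_bounded U B -> exists2 d : R, 0 < d & d <= 1 /\
    forall z, B z -> forall w, rnorm (w - z) <= d -> U w.
Proof.
move=> [_ _ [_ /gt0_of_real[e e0 ->] eU]].
(* The margin is [e / (1 + e)]: at most 1, and strictly below [e] so that closed balls of this
   radius stay in [U]. *)
have e1 : 0 < 1 + e^-1 by rewrite ltr_wpDr ?invr_ge0 ?ltW.
have e1e : (1 + e^-1)^-1 < e by rewrite invf_plt ?posrE//; lra.
exists (1 + e^-1)^-1; first by rewrite invr_gt0.
split; first by rewrite invf_le1// lerDl invr_ge0 ltW.
move=> z Bz w wz; apply: contrapT => nUw.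
have := eU z w Bz nUw; rewrite normE le_of_real rnorm_distrC; lra.
Qed.

(** Singletons in an open set are [U]-bounded. *)
Lemma sub_envelope (U : set (dual X)) :
  open U -> U `<=` envelope U.
Proof.
move=> oU f Uf; exists [set f]; last exact: subset_closure.
split.
- by move=> _ ->.
- by exists `|f|; split=> [|M /ltW fM _ ->//]; exact: normr_real.
have /nbhs_normP[d /= d0 dU] : nbhs f U by exact: open_nbhs_nbhs.
exists d => // _ g -> nUg; have [e e0 dE] := gt0_of_real d d0.
rewrite dE normE le_of_real leNgt; apply/negP => fg; apply: nUg; apply: dU.
by rewrite /= dE normE lt_of_real.
Qed.

End envelope.

Theorem theorem2p2 (R : realType) (k : scalar_kind)
    (X : completeNormedModType (scalars R k)) :
  separable X ->
  (exists2 eps : scalars R k, 0 < eps &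
     forall W : set (weak_star X), open W ->
       closed_unit_ball (dual X) `&` W !=set0 ->
       eps <= diameter (closed_unit_ball (dual X) `&` W)) ->
  exists U : set (dual X),
    [/\ balanced U, open U, U `<` open_unit_ball (dual X), envelope U = U &
        open_unit_ball (dual X) `<=` weak_star_closure U].
Proof.
move=> sepX [_ /gt0_of_real[e e0 ->] diam_ge].
pose delta := e / 5.
have delta0 : 0 < delta by rewrite /delta; lra.
have [W [oW W_sep]] := weak_star_ball_base sepX.
have [|x [x1 xd x_sep xW]] := separated_sequence diam_ge delta W delta0 _ oW.
  by rewrite /delta; lra.
clearbody delta.
have delta1 : delta <= 1 := le_trans (xd 0%N) (x1 0%N).
(* With [delta <= 1] this makes [r] at most [12 * delta / 25], below [delta / 2]. *)
pose q := delta ^+ 2 / 25.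
have q0 : 0 < q by rewrite /q divr_gt0// exprn_gt0.
pose r := 4 * q * (1 + 2 / delta).
have rE : r = delta * (4 * delta + 8) / 25.
  rewrite /r /q; field; exact: lt0r_neq0.
have r_delta : r < delta / 2 by rewrite rE; nra.
have q_r := (lexx r : 4 * q * (1 + 2 / delta) <= r).
pose U := @tubes R k (dual X) x q r.
have oU : open U := open_tubes.
have U1 : U `<=` open_unit_ball (dual X).
  by move=> z Uz; apply/open_unit_ballP; exact: (@tubes_lt1 _ _ _ x delta q r).
exists U; split => //.
- exact: tubes_balanced.
- by split => //; exact: (@tubes_proper _ _ _ x delta q r).
- apply/seteqP; split; last exact: sub_envelope.
  move=> f [B /U_bounded_margin[d d0 [d1 dB]] Bf].
  have [c c1 [bs bsP bsU]] : exists2 c : R, _ & exists2 bs, _ & _ :=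
    @tubes_cover _ _ _ x delta q r delta0 x1 xd x_sep q0 q_r r_delta d d0 d1.
  (* Both the norm bound [c] and the finite cover pass to the weak* closure; together they put [f]
     in [U]. *)
  have [b] : exists2 b, b \in [:: (0 : dual X, c)] & rnorm (f - b.1) <= b.2.
    apply: weak_star_closure_balls Bf => g Bg; exists (0, c); first by rewrite inE.
    by rewrite subr0; have [] := bsP g (dB g Bg).
  rewrite inE => /eqP -> /=; rewrite subr0 => fc.
  have [b' b'bs fb'] : exists2 b, b \in bs & rnorm (f - b.1) <= b.2.
    by apply: weak_star_closure_balls Bf => g Bg; have [] := bsP g (dB g Bg).
  exact: bsU fb'.
move=> f /open_unit_ballP f1.
(* Each [W (m j)] meets the dual ball at [f], so it contains [x (m j)]; these points converge weak*
   to [f]. *)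
have [m [fm mP]] := W_sep f (ltW f1).
have xm j : W (m j) (x (m j)).
  by apply: xW; exists f; split => //; apply/closed_unit_ballP/ltW.
apply: (@weak_star_closure_multiples _ _ _ U (x \o m)) => [j|j c c0 c1|].
- exact: x1.
- exact: multiple_in_tubes.
- exact: (mP (x \o m) (fun j => x1 (m j)) xm).
Qed.
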